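(* If $(k_n)_{n=1}^{\infty}$ is any sequence of positive integers such that $k_n\to\infty$ and $k_n=o(n)$, then, under the measures $\mathbb{P}_{n,k_n}$, $$\frac{L}{\mathbb{E}_{n,k_n}(L)}\longrightarrow 1\quad\text{in probability, as } n\to\infty.$$
   Context: For positive integers $k,n$, the $k$-card-minimum ($k$CM) procedure generates a random permutation of $\{1,\dots,n\}$ as follows. Let $D_1=\{1,\dots,n\}$. For $t=1,\dots,n$: given the past, $C_{t,1},\dots,C_{t,k}$ are i.i.d. uniform samples from $D_t$; $C_t=\min\{C_{t,1},\dots,C_{t,k}\}$; and $D_{t+1}=D_t\setminus\{C_t\}$. The resulting permutation is $\sigma=(C_1,\dots,C_n)$. $\mathbb{P}_{n,k}$ denotes the probability measure of this procedure with parameters $n,k$, and $\mathbb{E}_{n,k}$ denotes expectation under it. $L=L(\sigma)=\max\{\ell:\exists\,1\le i_1<\dots<i_\ell\le n \text{ with }\sigma(i_1)<\dots<\sigma(i_\ell)\}$ is the length of the longest increasing subsequence of $\sigma$. Convergence in probability means $\mathbb{P}_{n,k_n}(|L/\mathbb{E}_{n,k_n}(L)-1|>\epsilon)\to 0$ as $n \to \infty$ for every $\epsilon>0$. *)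

(* Defs.v *)
From mathcomp Require Import all_boot all_order all_algebra perm.
From mathcomp Require Import all_classical all_reals all_analysis.
Set Implicit Arguments.
Unset Strict Implicit.
Unset Printing Implicit Defensive.
Import Order.TTheory GRing.Theory Num.Theory.
Import numFieldNormedType.Exports.
Local Open Scope ring_scope.

(* Times, samples and cards are numbered from 0: the deck {1, ..., n} and the
   times 1, ..., n are both represented by 'I_n. *)

(* All the draws of one run: [w t i] is the i-th card sampled at time t. *)
Definition draws (n k : nat) := {ffun 'I_n -> {ffun 'I_k -> 'I_n}}.

(* C_t, as a nat.  For 0 < k every sample is < n, so the default value n of the
   iterated minimum plays no role. *)
Definition card_min (n k : nat) (w : draws n k) (t : 'I_n) : nat :=
  \big[minn/n]_(i < k) (w t i : nat).

Definition deck (n k : nat) (w : draws n k) (t : 'I_n) : {set 'I_n} :=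
  [set c : 'I_n | [forall s : 'I_n, (s < t)%N ==> (card_min w s != c)]].

Definition unif_mass (R : realType) (T : finType) (D : {set T}) (c : T) : R :=
  (c \in D)%:R / #|D|%:R.

(* Joint law of the draws, by the chain rule: given the draws before time t
   (which determine [deck w t]), the k samples at time t are i.i.d. uniform
   on [deck w t]. *)
Definition draws_mass (R : realType) (n k : nat) (w : draws n k) : R :=
  \prod_(t < n) \prod_(i < k) unif_mass R (deck w t) (w t i).

(* Law of sigma = (C_1, ..., C_n): the image of the law of the draws. *)
Definition kcm_mass (R : realType) (n k : nat) (s : 'S_n) : R :=
  \sum_(w : draws n k | [forall t, card_min w t == s t]) draws_mass R w.

Definition kcm_prob (R : realType) (n k : nat) (A : pred 'S_n) : R :=
  \sum_(s : 'S_n | A s) kcm_mass R k s.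

Definition kcm_expect (R : realType) (n k : nat) (X : 'S_n -> R) : R :=
  \sum_(s : 'S_n) kcm_mass R k s * X s.

(* The largest l such that i_1 < ... < i_l and s(i_1) < ... < s(i_l) for some
   l-tuple of positions; no such tuple exists for l > n. *)
Definition lis (n : nat) (s : 'S_n) : nat :=
  \max_(l < n.+1 | [exists p : l.-tuple 'I_n,
                     sorted (fun i j : 'I_n => (i < j)%N && (s i < s j)%N) p]) l.

(* Main.v *)
Require Import Defs.
From mathcomp Require Import all_boot all_order all_algebra perm.
From mathcomp Require Import all_classical all_reals all_analysis.
From mathcomp Require Import zify ring lra.
Set Implicit Arguments.
Unset Strict Implicit.
Unset Printing Implicit Defensive.
Import Order.TTheory GRing.Theory Num.Theory.
Import numFieldNormedType.Exports.
Local Open Scope ring_scope.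

(** The permutation is determined by the ranks of the successive cards in the
    decks they are taken from (its Lehmer code), and under the procedure these
    ranks are independent: in a deck of [m] cards the minimum of [k] uniform
    samples has rank [j] with probability [((m-j)^k - (m-j-1)^k) / m^k].  All
    probabilities are therefore computed on sequences of ranks
    ([kcm_expect_rank]), and the theorem is Chebyshev's inequality together
    with two estimates.

    Variance.  The longest increasing subsequence can be read off the ranks by
    a recursion [rlis] which only remembers how many cards still in the deck
    lie below the last card selected.  Changing a single rank changes its value
    by at most 1 ([rlis_change_one]), so conditioning on the ranks one after
    the other bounds the variance of [L] by [n] ([rank_variance_le]).

    Mean.  Fix a window [w] and select greedily: take the next card whenever it
    lies above the last selected one, with fewer than [w] cards of the deck
    between the two.  Let [h] be the number of cards of the deck below the last
    selected card.  Each selection raises [h] by less than [w], and each draw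
    below the last selected card lowers it by 1, so there are at most [w] times
    as many such draws as selections.  Among the other draws, selections are at
    least [a = k w / n] times as frequent as draws beyond the window, by
    Bernoulli's inequality.  A potential function turns this into
    [(1 + a w) E L >= a n] ([rlis_expect_lower]); choosing [w] of the order of
    [sqrt (n / k)] gives [(E L)^2 >= k n / 25] ([mean_rlis_lower]).

    Hence the probability of a relative deviation larger than [eps] is at most
    [n / (eps E L)^2 <= 25 / (eps^2 k)], which tends to 0 as [k] tends to
    infinity.  The choice of the window relies on [k <= n], true for large [n]
    because [k = o(n)]. *)

(** * Increasing subsequences and Lehmer codes *)

Fixpoint code (l : seq nat) : seq nat :=
  if l is x :: l' then count (fun y => (y < x)%N) l' :: code l' else [::].

(** The longest increasing subsequence of a deck uncovered in the order given by
    the ranks [r], among the cards which are not the lowest [b] of the deck.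
    Only the number of forbidden cards still in the deck matters: a forbidden
    card that comes up lowers it by 1, and selecting the card of rank [j] sets
    it to [j]. *)
Fixpoint rlis (b : nat) (r : seq nat) : nat :=
  if r is j :: r' then
    if (j < b)%N then rlis b.-1 r' else maxn (rlis b r') (rlis j r').+1
  else 0%N.

(** An increasing subsequence contains the lowest allowed card at most once, so
    forbidding that card costs at most 1. *)
Lemma rlis_thresholdS (b : nat) (r : seq nat) :
  (rlis b.+1 r <= rlis b r <= (rlis b.+1 r).+1)%N.
Proof.
elim: r b => [|j r IH] b //=.
have H := IH b; have := IH b.-1.
case: (ltngtP j b) => [jb|bj|->].
- by rewrite (ltn_predK jb) ltnS (ltnW jb).
- by case: ifP => ?; lia.
- by case: ifP => ?; lia.
Qed.

Lemma rlis_threshold_mono (b c : nat) (r : seq nat) :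
  (b <= c)%N -> (rlis c r <= rlis b r)%N.
Proof.
move=> /subnKC <-; elim: (c - b)%N => [|d IH]; first by rewrite addn0.
by rewrite addnS; apply: leq_trans IH; case/andP: (rlis_thresholdS (b + d) r).
Qed.

(** Whatever its rank, one more card in front brings a gain between 0 and 1; the
    bounds do not mention [j], which is why replacing [j] is harmless. *)
Lemma rlis_head_bounds (b j : nat) (r : seq nat) :
  (rlis b r <= rlis b (j :: r) <= (rlis b r).+1)%N.
Proof.
rewrite /=; case: ltnP => [jb|bj].
  by have := rlis_thresholdS b.-1 r; rewrite (ltn_predK jb).
by have := @rlis_threshold_mono _ _ r bj; lia.
Qed.

(** The bounded difference property.  It passes through a common prefix because
    [maxn] is 1-Lipschitz. *)
Lemma rlis_change_one (p q : seq nat) (i j b : nat) :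
  (rlis b (p ++ i :: q) <= (rlis b (p ++ j :: q)).+1)%N.
Proof.
elim: p b => [|a p IH] b.
  have /andP[_] := rlis_head_bounds b i q.
  have /andP[+ _] := rlis_head_bounds b j q.
  by rewrite !cat0s; lia.
by rewrite /=; have := IH b.-1; have := IH b; have := IH a; case: ltnP => _; lia.
Qed.

Lemma leq_count_ltn (c x : nat) (l : seq nat) : (c <= x)%N ->
  (count (fun y => (y < c)%N) l <= count (fun y => (y < x)%N) l)%N.
Proof. by move=> cx; apply: sub_count => y /= /leq_trans; apply. Qed.

Lemma count_leq_notin (x : nat) (l : seq nat) : x \notin l ->
  count (fun y => (y < x.+1)%N) l = count (fun y => (y < x)%N) l.
Proof.
move=> xl; apply: eq_in_count => y yl; rewrite ltnS leq_eqVlt.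
by case: eqP => // yx; rewrite -yx yl in xl.
Qed.

(** The recursion of [rlis], with forbidden cards described by their values
    (those below [c]) instead of their number. *)
Lemma rlis_code_cons (c x : nat) (l : seq nat) : x \notin l ->
  rlis (count (fun y => (y < c)%N) (x :: l)) (code (x :: l)) =
  if (x < c)%N then rlis (count (fun y => (y < c)%N) l) (code l)
  else maxn (rlis (count (fun y => (y < c)%N) l) (code l))
            (rlis (count (fun y => (y < x.+1)%N) l) (code l)).+1.
Proof.
move=> xl; rewrite /=; case: (ltnP x c) => [xc|cx] /=.
  by rewrite add1n ltnS leq_count_ltn // ltnW.
by rewrite add0n ltnNge leq_count_ltn //= count_leq_notin.
Qed.

Lemma rlis_code_ub (c : nat) (l q : seq nat) :
    uniq l -> subseq q l -> sorted ltn q -> all (leq c) q ->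
  (size q <= rlis (count (fun y => (y < c)%N) l) (code l))%N.
Proof.
elim: l c q => [|x l IH] c q; first by move=> _ /eqP ->.
case/andP=> xl ul; case: q => [|y q] // sub sq /[dup] acq /andP[cy cq].
rewrite rlis_code_cons //; move: sub; rewrite [subseq _ _]/=.
case: (eqVneq y x) => [yx|yx] sub; last first.
  by case: ifP => _; rewrite ?leq_max IH.
subst y; rewrite ltnNge cy /= leq_max ltnS IH ?orbT //.
  exact: path_sorted sq.
by apply: order_path_min sq; apply: ltn_trans.
Qed.

Lemma rlis_code_attained (c : nat) (l : seq nat) : uniq l ->
  exists q, [/\ subseq q l, sorted ltn q, all (leq c) q &
    size q = rlis (count (fun y => (y < c)%N) l) (code l)].
Proof.
elim: l c => [|x l IH] c; first by exists [::].
case/andP=> xl ul; rewrite rlis_code_cons //.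
have [q [qs sq aq <-]] := IH c ul.
have qs' : subseq q (x :: l) by apply: subseq_trans qs (subseq_cons _ _).
case: ltnP => [xc|cx]; first by exists q.
have [p [ps sp ap <-]] := IH x.+1 ul.
case: (leqP (size p).+1 (size q)) => pq; first by exists q.
exists (x :: p); split=> //=; first by rewrite eqxx.
  by case: p sp ap {ps pq} => //= y p -> /andP[->].
by rewrite cx; apply: sub_all ap => y /ltnW /(leq_trans cx).
Qed.

Definition word n (s : 'S_n) : seq nat := [seq val (s i) | i <- enum 'I_n].

Lemma word_uniq n (s : 'S_n) : uniq (word s).
Proof. by rewrite map_inj_uniq ?enum_uniq // => i j /val_inj /perm_inj. Qed.

Lemma sorted_ltn_enum_subseq n (p : seq 'I_n) :
  sorted (fun i j : 'I_n => (i < j)%N) p = subseq p (enum 'I_n).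
Proof.
have tr : transitive (fun i j : 'I_n => (i < j)%N) by move=> ? ? ?; apply: ltn_trans.
have se : sorted (fun i j : 'I_n => (i < j)%N) (enum 'I_n).
  have := iota_ltn_sorted 0 n; rewrite -val_enum_ord.
  by rewrite sorted_map.
apply/idP/idP => [sp|sub]; last exact: subseq_sorted tr _ _ sub se.
suff -> : p = [seq i <- enum 'I_n | i \in p] by apply: filter_subseq.
apply: (irr_sorted_eq tr) => // [i||i]; first exact: ltnn.
  exact: sorted_filter.
by rewrite mem_filter mem_enum andbT.
Qed.

(** Increasing tuples of positions are the subsequences of [enum 'I_n] on which
    [s] increases; their images are the increasing subsequences of [word s]. *)
Lemma lis_rlis n (s : 'S_n) : lis s = rlis 0 (code (word s)).
Proof.
have c0 : count (fun y => (y < 0)%N) (word s) = 0%N by elim: (word s).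
pose e := (fun i j : 'I_n => (i < j)%N && (s i < s j)%N).
have eE p : sorted e p = subseq p (enum 'I_n) && sorted ltn [seq val (s i) | i <- p].
  rewrite -sorted_ltn_enum_subseq sorted_map.
  exact: (@sorted_relI _ (fun i j : 'I_n => (i < j)%N) (fun i j => (s i < s j)%N)).
apply/eqP; rewrite eqn_leq; apply/andP; split.
  apply/bigmax_leqP => l /existsP[p]; rewrite -/e eE => /andP[ps ss].
  rewrite -[X in (X <= _)%N](size_tuple p) -(size_map (fun i => val (s i))) -c0.
  apply: rlis_code_ub ss _; first exact: word_uniq.
    exact: map_subseq.
  by apply/allP.
have [q [/subseqP[m _ qm] sq _]] := rlis_code_attained 0 (word_uniq s).
rewrite c0 => <-.
rewrite /word -map_mask in qm.
pose p := mask m (enum 'I_n).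
have ps : subseq p (enum 'I_n) by apply: mask_subseq.
have pq : size q = size p by rewrite qm size_map.
have pn : (size p < n.+1)%N by rewrite ltnS -[X in (_ <= X)%N]size_enum_ord size_subseq.
rewrite pq; apply: (@leq_bigmax_cond _ _ _ (Ordinal pn)).
apply/existsP; exists (in_tuple p) => /=.
by rewrite -/e eE ps -qm.
Qed.

(** * Expectations over independent ranks *)

Section RankExpectation.
Variables (R : realType) (k : nat).
Hypothesis k_gt0 : (0 < k)%N.

(** The law of the rank of the minimum of [k] uniform samples from [m] cards:
    [(m - j)^k / m^k] is the probability that all samples have rank at least
    [j]. *)
Definition rank_mass (m j : nat) : R :=
  ((m - j)%:R ^+ k - (m - j.+1)%:R ^+ k) / m%:R ^+ k.

(** Expectation of [F (r_m, ..., r_1)], where the independent ranks [r_i] have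
    law [rank_mass i].  The recursive form makes conditioning on the first rank
    definitional. *)
Fixpoint rank_expect (m : nat) (F : seq nat -> R) : R :=
  if m is m'.+1 then
    \sum_(j < m) rank_mass m j * rank_expect m' (fun r => F (nat_of_ord j :: r))
  else F [::].

Lemma rank_mass_ge0 (m j : nat) : 0 <= rank_mass m j.
Proof.
by rewrite divr_ge0 ?exprn_ge0 // subr_ge0 lerXn2r ?nnegrE // ler_nat; lia.
Qed.

Lemma sum_rank_mass (m a b : nat) : (a <= b)%N ->
  \sum_(a <= j < b) rank_mass m j =
  ((m - a)%:R ^+ k - (m - b)%:R ^+ k) / m%:R ^+ k.
Proof.
move=> ab; rewrite -mulr_suml; congr (_ / _).
under eq_bigr do rewrite -opprB.
by rewrite sumrN telescope_sumr // opprB.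
Qed.

Lemma sum_rank_mass_total (m : nat) : (0 < m)%N ->
  \sum_(j < m) rank_mass m j = 1.
Proof.
move=> m0; rewrite -(big_mkord xpredT (rank_mass m)) sum_rank_mass // subn0 subnn.
by rewrite expr0n gtn_eqF // subr0 divff // expf_neq0 // pnatr_eq0 -lt0n.
Qed.

Lemma rank_expect_le (m : nat) (F G : seq nat -> R) :
  (forall r, F r <= G r) -> rank_expect m F <= rank_expect m G.
Proof.
elim: m F G => [|m IH] F G FG /=; first exact: FG.
by apply: ler_sum => j _; rewrite ler_wpM2l ?rank_mass_ge0 // IH.
Qed.

Lemma eq_rank_expect (m : nat) (F G : seq nat -> R) :
  F =1 G -> rank_expect m F = rank_expect m G.
Proof. by move=> /funext ->. Qed.

Lemma rank_expect_cst (m : nat) (c : R) : rank_expect m (fun=> c) = c.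
Proof.
elim: m => [|m IH] //=; rewrite IH -mulr_suml.
by rewrite sum_rank_mass_total // mul1r.
Qed.

Lemma rank_expectD (m : nat) (F G : seq nat -> R) :
  rank_expect m (fun r => F r + G r) = rank_expect m F + rank_expect m G.
Proof.
elim: m F G => [|m IH] F G //=; rewrite -big_split /=.
by apply: eq_bigr => j _; rewrite IH mulrDr.
Qed.

Lemma rank_expectZ (m : nat) (c : R) (F : seq nat -> R) :
  rank_expect m (fun r => c * F r) = c * rank_expect m F.
Proof.
elim: m F => [|m IH] F //=; rewrite mulr_sumr.
by apply: eq_bigr => j _; rewrite IH mulrCA.
Qed.

Lemma mean_dev_le (m : nat) (g : nat -> R) (i : nat) : (0 < m)%N ->
  (forall i j, g i <= g j + 1) ->
  (g i - \sum_(j < m) rank_mass m j * g j) ^+ 2 <= 1.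
Proof.
move=> m0 gosc; rewrite -[X in X <= _]real_normK ?num_real // expr_le1 //.
rewrite ler_norml; apply/andP.
set mu := \sum_(j < m) _.
have cst c : c = \sum_(j < m) rank_mass m j * c.
  by rewrite -mulr_suml sum_rank_mass_total // mul1r.
have mu1 : mu <= g i + 1.
  by rewrite (cst (g i + 1)); apply: ler_sum => j _; rewrite ler_wpM2l ?rank_mass_ge0.
have mu2 : g i - 1 <= mu.
  rewrite (cst (g i - 1)); apply: ler_sum => j _; rewrite ler_wpM2l ?rank_mass_ge0 //.
  by rewrite lerBlDr.
by split; lra.
Qed.

(** The variance splits into the conditional variance given the first rank,
    bounded by induction, and the variance of the conditional mean [g], which
    inherits the bounded difference property from [F] and so contributes at
    most 1. *)
Lemma rank_variance_le (m : nat) (F : seq nat -> R) :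
    (forall p q i j, F (p ++ i :: q) <= F (p ++ j :: q) + 1) ->
  rank_expect m (fun r => (F r - rank_expect m F) ^+ 2) <= m%:R.
Proof.
elim: m F => [|m IH] F Fosc; first by rewrite /= subrr expr0n.
pose g j := rank_expect m (fun r => F (j :: r)).
have muE : rank_expect m.+1 F = \sum_(j < m.+1) rank_mass m.+1 j * g j by [].
have gosc i j : g i <= g j + 1.
  rewrite -(rank_expect_cst m 1) -rank_expectD; apply: rank_expect_le => r.
  exact: (Fosc [::]).
set mu := rank_expect m.+1 F.
have mean i : (g i - mu) ^+ 2 <= 1 by rewrite /mu muE mean_dev_le.
rewrite /= -[X in _ <= X]mul1r -[X in _ <= X * _](sum_rank_mass_total (ltn0Sn m)).
rewrite mulr_suml.
apply: ler_sum => j _; rewrite ler_wpM2l ?rank_mass_ge0 //.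
have -> : rank_expect m (fun r => (F (nat_of_ord j :: r) - mu) ^+ 2) =
    rank_expect m (fun r => (F (nat_of_ord j :: r) - g j) ^+ 2) + (g j - mu) ^+ 2.
  pose d := g j - mu.
  transitivity (rank_expect m (fun r => (F (nat_of_ord j :: r) - g j) ^+ 2
      + (2 * d * F (nat_of_ord j :: r) + (d ^+ 2 - 2 * d * g j)))).
    by apply: eq_rank_expect => r; rewrite /d; ring.
  rewrite rank_expectD; congr (_ + _).
  by rewrite rank_expectD rank_expectZ rank_expect_cst -/(g j) /d; ring.
rewrite -natr1 lerD //.
apply: (IH (fun r => F (nat_of_ord j :: r))) => p q a b.
by apply: (Fosc (nat_of_ord j :: p)).
Qed.

Lemma bernoulli_le (a : R) (p : nat) : 0 <= a -> 1 + p%:R * a <= (1 + a) ^+ p.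
Proof.
move=> a0; elim: p => [|p IH]; first by rewrite mul0r addr0 expr0.
rewrite exprS; apply: le_trans (ler_wpM2l _ IH); last by rewrite addr_ge0.
have : 0 <= p%:R * a * a by rewrite !mulr_ge0.
by rewrite -natr1; nra.
Qed.

(** The invariant behind the greedy selection with window [w], with [h] cards
    currently below the last selected one.  The potential [a * (m - h)] is kept
    by a draw below, since [m] and [h] both drop by 1; it drops by [a] after a
    draw beyond the window, and by at most [a * w] after a selection, which in
    turn contributes [1 + a * w] and so leaves a surplus of 1. *)
Lemma rlis_expect_lower (n w m h : nat) : (0 < n)%N ->
    (h <= m)%N -> (m <= n)%N ->
  let a : R := k%:R * w%:R / n%:R in
  a * (m - h)%:R <= (1 + a * w%:R) * rank_expect m (fun r => (rlis h r)%:R).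
Proof.
move=> n0 hm mn; set a : R := k%:R * w%:R / n%:R => /=.
have n0' : 0 < n%:R :> R by rewrite ltr0n.
have a0 : 0 <= a by rewrite divr_ge0 ?mulr_ge0.
have aw : 0 <= 1 + a * w%:R by rewrite addr_ge0 ?mulr_ge0.
elim: m h hm mn => [|m IH] h hm mn.
  by rewrite /= mulr0 mulr_ge0.
(* The surplus (or deficit) left by a draw of rank [j]. *)
pose u j : R := if (j < h)%N then 0 else if (j < h + w)%N then 1 else - a.
(* On average it is nonnegative.  With [x] cards beyond the window and [y] above
   the last selected card, this reads [x^k * (1 + a) <= y^k]; the window is cut
   at the top of the deck, where [x = 0]. *)
have gain : 0 <= \sum_(0 <= j < m.+1) rank_mass m.+1 j * u j.
  pose e := minn (h + w) m.+1.
  have he : (h <= e)%N by rewrite /e leq_min leq_addr.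
  have em : (e <= m.+1)%N by rewrite /e geq_minr.
  rewrite (@big_cat_nat _ _ _ h) //= (@big_cat_nat _ _ _ e h) //=.
  rewrite [X in 0 <= X + _]big1_seq ?add0r; last first.
    by move=> j; rewrite mem_index_iota => /andP[_ /andP[_ jh]]; rewrite /u jh mulr0.
  rewrite [X in 0 <= X + _](eq_big_seq (rank_mass m.+1)); last first.
    move=> j; rewrite mem_index_iota => /andP[hj je]; rewrite /u ltnNge hj /=.
    by rewrite (leq_trans je) ?geq_minl // mulr1.
  rewrite [X in 0 <= _ + X](eq_big_seq (fun j => rank_mass m.+1 j * - a)); last first.
    move=> j; rewrite mem_index_iota => /andP[ej jm]; rewrite /u.
    have hwj : (h + w <= j)%N by move: ej; rewrite /e; lia.
    by rewrite !ltnNge hwj (leq_trans (leq_addr w h) hwj).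
  rewrite -[X in 0 <= _ + X]mulr_suml !sum_rank_mass // subnn expr0n gtn_eqF // subr0.
  rewrite mulrAC -mulrDl divr_ge0 ?exprn_ge0 //.
  set x : R := (m.+1 - e)%:R; set y : R := (m.+1 - h)%:R.
  have xy : x * (1 + w%:R / n%:R) <= y.
    have [x0|x0] := eqVneq (m.+1 - e)%N 0%N; first by rewrite /x x0 mul0r.
    have -> : y = x + w%:R.
      by rewrite /x /y -natrD /e; congr _%:R; move: x0; rewrite /e; lia.
    rewrite mulrDr mulr1 lerD2l mulrCA ler_piMr // ler_pdivrMr // mul1r ler_nat.
    exact: leq_trans (leq_subr _ _) mn.
  have xyk : x ^+ k * (1 + w%:R / n%:R) ^+ k <= y ^+ k.
    by rewrite -exprMn lerXn2r // nnegrE // mulr_ge0 // addr_ge0 // divr_ge0.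
  have := @bernoulli_le (w%:R / n%:R) k (divr_ge0 (ler0n _ _) (ler0n _ _)).
  rewrite mulrA -/a => bern.
  have : x ^+ k * (1 + a) <= y ^+ k.
    by apply: le_trans xyk; rewrite ler_wpM2l // exprn_ge0.
  by lra.
rewrite /= mulr_sumr.
apply: (@le_trans _ _ (\sum_(j < m.+1) rank_mass m.+1 j * (a * (m.+1 - h)%:R + u j))).
  under eq_bigr do rewrite mulrDr.
  rewrite big_split /= -mulr_suml sum_rank_mass_total // mul1r lerDl.
  by move: gain; rewrite big_mkord.
apply: ler_sum => j _; rewrite mulrCA ler_wpM2l ?rank_mass_ge0 // /u.
case: ltnP => [jh|hj].
  rewrite addr0 -(_ : (m - h.-1 = m.+1 - h)%N) ?IH //; try lia.
case: ltnP => [jw|wj].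
  apply: (@le_trans _ _ ((1 + a * w%:R) * (rank_expect m (fun r => (rlis j r)%:R) + 1))).
    rewrite mulrDr mulr1.
    apply: le_trans (lerD (IH j _ _) (lexx _)); [|by have := ltn_ord j; lia|by lia].
    have : a * (m.+1 - h)%:R <= a * (m - j)%:R + a * w%:R.
      by rewrite -mulrDr ler_wpM2l // -natrD ler_nat; lia.
    by lra.
  rewrite ler_wpM2l // -[X in _ + X](rank_expect_cst m 1) -rank_expectD.
  by apply: rank_expect_le => r; rewrite natr1 ler_nat leq_maxr.
apply: (@le_trans _ _ ((1 + a * w%:R) * rank_expect m (fun r => (rlis h r)%:R))).
  apply: le_trans (IH h _ _); [|by have := ltn_ord j; lia|by lia].
  rewrite -[X in _ - X]mulr1 -mulrBr ler_wpM2l // lerBlDr natr1 ler_nat; lia.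
by rewrite ler_wpM2l //; apply: rank_expect_le => r; rewrite ler_nat leq_maxl.
Qed.

End RankExpectation.

(** * The law of the code of the random permutation *)

Section Law.
Variables (R : realType) (k : nat).

Fixpoint code_mass (r : seq nat) : R :=
  if r is j :: r' then rank_mass R k (size r) j * code_mass r' else 1.

Lemma size_code (l : seq nat) : size (code l) = size l.
Proof. by elim: l => //= x l ->. Qed.

Lemma sum_count_ltn (D : seq nat) (g : nat -> R) : uniq D ->
  \sum_(x <- D) g (count (fun y => (y < x)%N) D) = \sum_(j < size D) g j.
Proof.
move=> uD; have pD : perm_eq (sort leq D) D by rewrite perm_sort.
have sD : sorted ltn (sort leq D).
  by rewrite ltn_sorted_uniq_leq sort_uniq uD; apply: sort_sorted; apply: leq_total.
rewrite -(perm_big _ pD) (big_nth 0%N) -(perm_size pD) big_mkord.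
apply: eq_bigr => i _; congr g; rewrite -(seq.permP pD).
exact: (Order.POrderTheory.count_lt_nth 0%N sD (ltn_ord i)).
Qed.

(** The Lehmer code is a bijection from the arrangements of [D] to the admissible
    rank sequences: the first card runs over [D], its rank over all ranks. *)
Lemma sum_permutations (D : seq nat) (F : seq nat -> R) : uniq D ->
  \sum_(l <- permutations D) code_mass (code l) * F (code l) =
  rank_expect k (size D) F.
Proof.
move: {2}(size D) (erefl (size D)) => m mD; rewrite mD.
elim: m D F mD => [|m IH] D F mD uD.
  by move/size0nil: mD => ->; rewrite big_seq1 /= mul1r.
rewrite (perm_big _ (permutationsE _)) ?mD // undup_id // big_allpairs_dep /=.
rewrite -mD -(sum_count_ltn (fun j => rank_mass R k (size D) j *
  rank_expect k m (fun r => F (j :: r)))) //.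
apply: eq_big_seq => x xD.
have uxD : uniq (rem x D) by rewrite rem_uniq.
have sxD : size (rem x D) = m by rewrite size_rem // mD.
rewrite -(IH (rem x D)) // mulr_sumr; apply: eq_big_seq => l.
rewrite mem_permutations => pl.
have -> : count (fun y => (y < x)%N) D = count (fun y => (y < x)%N) l.
  by rewrite (seq.permP (perm_to_rem xD)) /= ltnn (seq.permP pl).
by rewrite /= size_code (perm_size pl) sxD mD mulrA.
Qed.

Lemma sum_perm_word n (G : seq nat -> R) :
  \sum_(s : 'S_n) G (word s) = \sum_(l <- permutations (iota 0 n)) G l.
Proof.
rewrite -big_enum -(big_map (@word n) xpredT).
apply: perm_big; apply: uniq_perm.
- rewrite map_inj_uniq ?enum_uniq // => s t /eq_in_map st.
  by apply/permP => i; apply: val_inj; apply: st; rewrite mem_enum.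
- exact: permutations_uniq.
move=> l; rewrite mem_permutations -val_enum_ord; apply/mapP/idP => [[s _ ->]|].
  rewrite /word (map_comp val s) perm_map //.
  apply: uniq_perm; [|exact: enum_uniq|].
    by rewrite map_inj_uniq ?enum_uniq //; apply: perm_inj.
  move=> i; rewrite mem_enum; apply/mapP; exists (s^-1%g i); rewrite ?mem_enum //.
  by rewrite permKV.
have en : size [seq val i | i <- enum 'I_n] == n by rewrite size_map size_enum_ord.
move=> pl; have /tuple_permP[s sE] : perm_eq l (Tuple en) by [].
exists s; first by rewrite mem_enum.
rewrite sE /word /= ; apply: eq_map => i.
by rewrite (tnth_nth 0%N) /= (nth_map i) ?size_enum_ord // nth_ord_enum.
Qed.

Lemma leq_bigmin (I : finType) (x n : nat) (F : I -> nat) : (x <= n)%N ->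
  (x <= \big[minn/n]_i F i)%N = [forall i, (x <= F i)%N].
Proof.
move=> xn; rewrite (big_morph (leq x) (leq_min x) (erefl _)) xn big_andE.
exact: eq_forallb.
Qed.

Lemma sample_tail_mass n (D : {set 'I_n}) (x : nat) : (x <= n)%N ->
  \sum_(v : {ffun 'I_k -> 'I_n} | (x <= \big[minn/n]_(i < k) (v i : nat))%N)
    \prod_(i < k) unif_mass R D (v i) =
  #|[set y in D | (x <= y)%N]|%:R ^+ k / #|D|%:R ^+ k.
Proof.
move=> xn; rewrite -expr_div_n.
have -> : #|[set y in D | (x <= y)%N]|%:R / #|D|%:R =
    \sum_(y < n | (x <= y)%N) unif_mass R D y.
  rewrite -mulr_suml -natr_sum -sum1_card; congr (_%:R / _).
  rewrite [RHS]big_mkcond [LHS]big_mkcond /=; apply: eq_bigr => y _.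
  by rewrite inE; case: (y \in D); case: (x <= y)%N.
transitivity (\prod_(i < k) \sum_(y < n | (x <= y)%N) unif_mass R D y); last first.
  by rewrite prodr_const card_ord.
rewrite bigA_distr_big_dep; apply: eq_bigl => v; rewrite leq_bigmin //.
Qed.

(** The event that the minimum is [c] is the difference of the tail events at
    [c] and [c + 1]. *)
Lemma sample_min_mass n (D : {set 'I_n}) (c : 'I_n) : c \in D ->
  \sum_(v : {ffun 'I_k -> 'I_n} | \big[minn/n]_(i < k) (v i : nat) == c)
    \prod_(i < k) unif_mass R D (v i) =
  rank_mass R k #|D| #|[set y in D | (y < c)%N]|.
Proof.
move=> cD; set j := #|[set y in D | (y < c)%N]|.
have jE : (#|[set y in D | (c <= y)%N]| = #|D| - j)%N.
  rewrite -(cardsID [set y : 'I_n | (y < c)%N] D) -setIdE addKn.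
  by apply: eq_card => y; rewrite !inE -leqNgt andbC.
have jSE : (#|[set y in D | (c < y)%N]| = #|D| - j.+1)%N.
  rewrite subnS -jE (cardsD1 c [set y in D | (c <= y)%N]) inE cD leqnn /=.
  by apply: eq_card => y; rewrite !inE ltn_neqAle eq_sym; case: (y \in D); rewrite ?andbF.
rewrite /rank_mass mulrBl -jE -jSE -!sample_tail_mass // ?(ltnW (ltn_ord c)) //.
rewrite big_mkcond [X in _ = X - _]big_mkcond [X in _ = _ - X]big_mkcond -sumrB.
apply: eq_bigr => v _; case: ltngtP => _; rewrite ?subrr ?subr0 //.
Qed.

Lemma code_mass_code n (f : 'I_n -> nat) :
  code_mass (code [seq f i | i <- enum 'I_n]) =
  \prod_(t < n) rank_mass R k (n - t) (\sum_(u < n) (t < u)%N && (f u < f t)%N).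
Proof.
elim: n f => [|n IH] f; first by rewrite big_ord0 enum_ord0.
rewrite big_ord_recl enum_ordSl /= size_code size_map size_map size_enum_ord subn0.
rewrite -map_comp IH big_ord_recl /= add0n; congr (rank_mass _ _ _ _ * _).
  rewrite -sum1_count big_map big_enum_cond /= big_mkcond; apply: eq_bigr => u _ /=.
  by case: ifP.
by apply: eq_bigr => t _; rewrite big_ord_recl.
Qed.

(** On the event that the draws produce [s], the deck at time [t] is determined
    by [s]; the sum over the draws then factorizes over the times. *)
Lemma kcm_mass_code n (s : 'S_n) : kcm_mass R k s = code_mass (code (word s)).
Proof.
rewrite /word code_mass_code /kcm_mass.
pose D t := s @: [set u : 'I_n | (t <= u)%N].
have DE (w : draws n k) t : (forall t, card_min w t == s t) -> deck w t = D t.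
  move=> ws; apply/setP => c; rewrite inE.
  have -> : (c \in D t) = (t <= s^-1%g c)%N.
    rewrite -[c in LHS](permKV s) mem_imset ?inE //. exact: perm_inj.
  apply/forallP/idP => [H|tc u].
    rewrite leqNgt; apply/negP => ct; move/implyP: (H (s^-1%g c)) => /(_ ct).
    by rewrite (eqP (ws _)) permKV eqxx.
  apply/implyP => ut; rewrite (eqP (ws _)) (inj_eq val_inj).
  apply/eqP => suc; move: tc; rewrite -suc permK leqNgt ut //.
transitivity (\prod_(t < n) \sum_(v : {ffun 'I_k -> 'I_n} |
    \big[minn/n]_(i < k) (v i : nat) == s t) \prod_(i < k) unif_mass R (D t) (v i)).
  rewrite bigA_distr_big_dep; apply: eq_big => [w|w /forallP ws]; first by [].
  by apply: eq_bigr => t _; rewrite DE.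
apply: eq_bigr => t _.
have stD : s t \in D t by rewrite mem_imset ?inE //; exact: perm_inj.
rewrite sample_min_mass //; congr rank_mass.
  rewrite card_imset; last exact: perm_inj.
  rewrite -sum1_card (eq_bigl (fun u : 'I_n => (t <= u)%N)); last first.
    by move=> u; rewrite inE.
  by rewrite -(big_geq_mkord t n (fun=> true) (fun=> 1%N)) sum_nat_const_nat muln1.
have -> : [set y in D t | (y < s t)%N] = s @: [set u : 'I_n | (t < u)%N && (s u < s t)%N].
  apply/setP => y; rewrite -[y](permKV s) inE !mem_imset ?inE; try exact: perm_inj.
  case: (ltngtP t) => //= /val_inj ->; by rewrite ltnn.
rewrite card_imset; last exact: perm_inj.
rewrite -sum1_card big_mkcond /=; apply: eq_bigr => u _; rewrite inE.
by case: ifP.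
Qed.

Lemma kcm_expect_rank n (F : nat -> R) :
  \sum_(s : 'S_n) kcm_mass R k s * F (lis s) =
  rank_expect k n (fun r => F (rlis 0 r)).
Proof.
under eq_bigr do rewrite kcm_mass_code lis_rlis.
rewrite (sum_perm_word n (fun l => code_mass (code l) * F (rlis 0 (code l)))).
by rewrite (sum_permutations (fun r => F (rlis 0 r))) ?iota_uniq // size_iota.
Qed.

End Law.

(** * Concentration *)

(** The least [w] with [n <= k w^2] overshoots by a factor at most 4: for
    [w >= 2] because [w <= 2 (w - 1)], and for [w = 1] because [k <= n]. *)
Lemma window_exists (n k : nat) : (0 < k)%N -> (k <= n)%N ->
  exists w, (n <= k * w ^ 2)%N /\ (k * w ^ 2 <= 4 * n)%N.
Proof.
move=> k0 kn; have ex : exists w, (n <= k * w ^ 2)%N.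
  by exists n; rewrite -[leqLHS]mul1n leq_mul // -[leqLHS]expn1 leq_pexp2l //; lia.
case: (ex_minnP ex) => -[|v] nv vmin; first by exists 0%N; split=> //; lia.
exists v.+1; split=> //.
have : (k * v ^ 2 < n)%N by rewrite ltnNge; apply/negP => /vmin; rewrite ltnn.
case: v {vmin nv} => [|v]; first by lia.
rewrite !expnS expn0 !muln1; nia.
Qed.

Section Concentration.
Variables (R : realType) (k n : nat).
Hypotheses (k_gt0 : (0 < k)%N) (k_le_n : (k <= n)%N).

Let mean : R := rank_expect k n (fun r => (rlis 0 r)%:R).

(** With [n <= k w^2 <= 4 n], the greedy bound gives [k w <= 5 E L], and
    [k n <= (k w)^2]. *)
Lemma mean_rlis_lower : k%:R * n%:R <= 25 * mean ^+ 2.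
Proof.
have n0 : (0 < n)%N by apply: leq_trans k_le_n.
have [w [nw wn]] := window_exists k_gt0 k_le_n.
have := @rlis_expect_lower R k k_gt0 n w n 0 n0 (leq0n n) (leqnn n).
rewrite -/mean /= subn0 divfK ?pnatr_eq0 -?lt0n //.
have n0' : 0 < n%:R :> R by rewrite ltr0n.
have aw : k%:R * w%:R / n%:R * w%:R <= 4 :> R.
  by rewrite mulrAC ler_pdivrMr // -!natrM ler_nat; move: wn; rewrite expnS expn1; lia.
have mean0 : 0 <= mean by rewrite -(rank_expect_cst k_gt0 n 0) rank_expect_le.
move=> low; have {low}low : k%:R * w%:R <= 5 * mean.
  apply: le_trans low _; rewrite ler_wpM2r //; lra.
have -> : 25 * mean ^+ 2 = (5 * mean) ^+ 2 by ring.
apply: (@le_trans _ _ ((k%:R * w%:R) ^+ 2)); last by rewrite lerXn2r // nnegrE ?mulr_ge0.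
rewrite exprMn expr2 -mulrA ler_wpM2l // -natrX -natrM ler_nat //.
Qed.

Lemma kcm_mass_ge0 (s : 'S_n) : 0 <= kcm_mass R k s.
Proof.
apply: sumr_ge0 => w _; apply: prodr_ge0 => t _; apply: prodr_ge0 => i _.
by rewrite divr_ge0.
Qed.

Lemma kcm_lis_chebyshev (eps : R) : 0 < eps ->
  kcm_prob R k (fun s : 'S_n =>
      eps < `|(lis s)%:R / kcm_expect k (fun s' : 'S_n => (lis s')%:R) - 1|)
    <= 25 / eps ^+ 2 / k%:R.
Proof.
move=> eps0.
have -> : kcm_expect k (fun s : 'S_n => (lis s)%:R) = mean.
  exact: (kcm_expect_rank k n (fun l => l%:R)).
have k0 : 0 < k%:R :> R by rewrite ltr0n.
have n0 : 0 < n%:R :> R by rewrite ltr0n; apply: leq_trans k_le_n.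
have low := mean_rlis_lower.
have mean2 : 0 < mean ^+ 2.
  have : 0 < k%:R * n%:R :> R by rewrite mulr_gt0.
  by lra.
have mean_neq0 : mean != 0 by rewrite -sqrf_eq0 gt_eqF.
pose c := (eps ^+ 2 * mean ^+ 2)^-1.
have c0 : 0 < c by rewrite invr_gt0 mulr_gt0 // exprn_gt0.
have dev x : eps < `|x / mean - 1| -> 1 <= c * (x - mean) ^+ 2.
  move=> ex; rewrite mulrC ler_pdivlMr ?mul1r; last by rewrite mulr_gt0 // exprn_gt0.
  have -> : x - mean = (x / mean - 1) * mean by rewrite mulrBl divfK // mul1r.
  rewrite exprMn ler_wpM2r ?(ltW mean2) // -[leRHS]real_normK ?num_real //.
  by rewrite lerXn2r ?nnegrE ?(ltW ex) ?(ltW eps0).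
apply: (@le_trans _ _ (c * n%:R)); last first.
  rewrite /c invfM -!mulrA [leRHS]mulrCA ler_wpM2l ?invr_ge0 ?sqr_ge0 //.
  by rewrite mulrC ler_pdivrMr // mulrAC ler_pdivlMr // mulrC.
apply: (@le_trans _ _ (\sum_(s : 'S_n) kcm_mass R k s * (c * ((lis s)%:R - mean) ^+ 2))).
  rewrite /kcm_prob big_mkcond; apply: ler_sum => s _; case: ifP => [/dev|_].
    by move=> ?; rewrite ler_peMr ?kcm_mass_ge0.
  by rewrite mulr_ge0 ?kcm_mass_ge0 // mulr_ge0 ?sqr_ge0 // ltW.
rewrite (kcm_expect_rank k n (fun l => c * (l%:R - mean) ^+ 2)).
rewrite rank_expectZ ler_pM2l //; apply: rank_variance_le => // p q i j.
by rewrite natr1 ler_nat rlis_change_one.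
Qed.

End Concentration.

Local Open Scope classical_set_scope.

Theorem theorem6 (R : realType) (k : nat -> nat)
    (k_gt0 : forall n : nat, (0 < n)%N -> (0 < k n)%N)
    (k_oo : k n @[n --> \oo] --> \oo)
    (k_littleo : (fun n : nat => (k n)%:R : R) =o_\oo (fun n : nat => n%:R : R)) :
  forall eps : R, 0 < eps ->
    kcm_prob R (k n) (fun s : 'S_n =>
        eps < `|(lis s)%:R / kcm_expect (k n) (fun s' : 'S_n => (lis s')%:R) - 1|)
      @[n --> \oo] --> (0 : R).
Proof.
move=> eps eps0; apply/cvgrPdist_le => e e0.
have k_le_n : \forall n \near \oo, (k n <= n)%N.
  move/eqoP: k_littleo => /(_ 1 ltr01); apply: filterS => n /=.
  by rewrite mul1r !normr_nat ler_nat.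
have k_big : forall A : nat, \forall n \near \oo, (A <= k n)%N by apply/cvgnyPge.
have C0 : 0 < 25 / eps ^+ 2 :> R by rewrite divr_gt0 ?exprn_gt0.
near=> n.
have kn : (k n <= n)%N by near: n.
have kC : 25 / eps ^+ 2 / e <= (k n)%:R.
  apply: (@le_trans _ _ (Num.truncn (25 / eps ^+ 2 / e)).+1%:R).
    by rewrite ltW // truncnS_gt.
  by rewrite ler_nat; near: n; apply: k_big.
have k0 : (0 < k n)%N by rewrite -(ltr0n R) (lt_le_trans _ kC) // divr_gt0.
rewrite sub0r normrN ger0_norm; last first.
  by apply: sumr_ge0 => s _; apply: kcm_mass_ge0.
apply: le_trans (kcm_lis_chebyshev k0 kn eps0) _.
by rewrite ler_pdivrMr ?ltr0n // [leRHS]mulrC -ler_pdivrMr.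
Unshelve. all: by end_near. Qed.
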